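(* Let $U,X$ be complex Hilbert spaces, let $\Sigma=(\mathbb{T},\Phi,\Psi,\mathbb{F})$ be an impedance passive well-posed linear system on $(U,X,U)$, and let $\phi:U\to U$ be locally Lipschitz continuous with $\phi(0)=0$ and such that there exist constants $\alpha,\beta,\delta>0$ with $$\mathrm{Re}\,\langle\phi(u),u\rangle\ge\alpha\|u\|^2\ \text{ when }\|u\|<\delta,\qquad\mathrm{Re}\,\langle\phi(u),u\rangle\ge\beta\ \text{ when }\|u\|\ge\delta.$$ Moreover, assume that the well-posed linear system $\Sigma^K=(\mathbb{T}^K,\Phi^K,\Psi^K,\mathbb{F}^K)$ obtained from $\Sigma$ by negative feedback $u=-y+v$ is such that the semigroup $\mathbb{T}^K$ is strongly stable. Let $x_0\in X$ be such that there exist $x\in C([0,\infty);X)$ and $y\in L^\infty(0,\infty;U)$ such that $$(\ast)\qquad x(t)=\mathbb{T}_tx_0+\Phi_t\mathbf{P}_t\phi(-y),\quad t\ge0,\qquad\qquad y=\Psi_\infty x_0+\mathbb{F}_\infty\phi(-y).$$ Then $\|x(t)\|\to0$ as $t\to\infty$, and $y\in L^2(0,\infty;U)$ and $\phi(-y)\in L^2(0,\infty;U)$. In particular, if for every $x_0\in X$ there exist $x\in C([0,\infty);X)$ and $y\in L^\infty(0,\infty;U)$ satisfying $(\ast)$, then $\|x(t)\|\to0$ as $t\to\infty$ and $y,\phi(-y)\in L^2(0,\infty;U)$ for every $x_0\in X$.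
   Context: $L^2_{\mathrm{loc}}(0,\infty;U)$ denotes the functions whose restriction to $(0,\tau)$ is in $L^2(0,\tau;U)$ for every $\tau>0$; $\mathbf{P}_\tau$ is truncation to $[0,\tau]$ (identified with extension by zero when needed). With $u\diamond_\tau v$ the function equal to $u$ on $[0,\tau)$ and $v(\cdot-\tau)$ on $[\tau,\infty)$, a well-posed linear system on $(U,X,Y)$ is $\Sigma=(\mathbb{T}_t,\Phi_t,\Psi_t,\mathbb{F}_t)_{t\ge0}$ with bounded linear $\mathbb{T}_t:X\to X$, $\Phi_t:L^2(0,\infty;U)\to X$, $\Psi_t:X\to L^2(0,\infty;Y)$, $\mathbb{F}_t:L^2(0,\infty;U)\to L^2(0,\infty;Y)$ such that $\mathbb{T}$ is a strongly continuous semigroup, $\Psi_0=0$, $\mathbb{F}_0=0$, $\Phi_{\tau+t}(u\diamond_\tau v)=\mathbb{T}_t\Phi_\tau u+\Phi_tv$, $\Psi_{\tau+t}x=\Psi_\tau x\diamond_\tau\Psi_t\mathbb{T}_\tau x$, $\mathbb{F}_{\tau+t}(u\diamond_\tau v)=\mathbb{F}_\tau u\diamond_\tau(\Psi_t\Phi_\tau u+\mathbb{F}_tv)$. $\Psi_\infty$ and $\mathbb{F}_\infty$ (with values in $L^2_{\mathrm{loc}}(0,\infty;Y)$, $\mathbb{F}_\infty$ defined on $L^2_{\mathrm{loc}}(0,\infty;U)$) are determined by $\mathbf{P}_t\Psi_\infty=\Psi_t$, $\mathbf{P}_t\mathbb{F}_\infty=\mathbb{F}_t\mathbf{P}_t$.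 The mild state trajectory and output of $\Sigma$ for $x_0\in X$, $u\in L^2_{\mathrm{loc}}(0,\infty;U)$ are $x(t)=\mathbb{T}_tx_0+\Phi_t\mathbf{P}_tu$, $y=\Psi_\infty x_0+\mathbb{F}_\infty u$. $\Sigma$ is impedance passive if $Y=U$ and all of these satisfy $\|x(t)\|_X^2-\|x_0\|_X^2\le2\,\mathrm{Re}\int_0^t\langle u(s),y(s)\rangle_U\,ds$ for $t\ge0$. $\Sigma^K$ is the well-posed linear system on $(U,X,U)$ whose mild state trajectory $x$ and output $y$ for initial state $x_0$ and input $v\in L^2_{\mathrm{loc}}(0,\infty;U)$ are the unique functions satisfying $x(t)=\mathbb{T}_tx_0+\Phi_t\mathbf{P}_t(v-y)$, $t\ge0$, and $y=\Psi_\infty x_0+\mathbb{F}_\infty(v-y)$ (it exists for impedance passive $\Sigma$). A semigroup $\mathbb{T}^K$ is strongly stable if $\mathbb{T}^K_tx_0\to0$ as $t\to\infty$ for all $x_0\in X$. *)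

(* Defs.v *)
From HB Require Import structures.
From mathcomp Require Export all_boot all_order all_algebra complex.
From mathcomp Require Export all_classical all_reals all_analysis.

Set Implicit Arguments.
Unset Strict Implicit.
Unset Printing Implicit Defensive.

Import Order.TTheory GRing.Theory Num.Theory.
Import numFieldNormedType.Exports.

Local Open Scope classical_set_scope.
Local Open Scope complex_scope.
Local Open Scope ring_scope.

(* Complex Hilbert spaces: complete normed R[i]-modules whose norm comes from
   a positive definite hermitian form, linear in its first argument. *)
HB.mixin Record NormedModule_isHilbert (R : realType) H
    of CompleteNormedModule R[i] H := {
  inner : {dot H for (@Num.conj R[i])} ;
  sqr_normr_inner : forall x : H, `|x| ^+ 2 = inner x x
}.

#[short(type="hilbertType")]
HB.structure Definition Hilbert (R : realType) :=
  { H of NormedModule_isHilbert R H & CompleteNormedModule R[i] H }.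

(* The norm and the inner product take values in R[i]; the R-valued norm is
   hnorm, and inner_re is the real part of the inner product. *)
Definition hnorm (R : realType) (H : hilbertType R) (x : H) : R :=
  complex.Re `|x|.
Definition inner_re (R : realType) (H : hilbertType R) (x y : H) : R :=
  complex.Re (inner x y).

Section FunctionSpaces.
Context {R : realType}.

(* Functions on (0, oo) are represented by total functions on R whose values
   on negative times are irrelevant; elements of L2 and L2loc are identified
   with their representatives, equality in these spaces being [ae_eq_pos]. *)

Let mu := @lebesgue_measure R.

Definition ae_eq_pos {T : Type} (f g : R -> T) : Prop :=
  {ae mu, forall s, 0 < s -> f s = g s}.

Definition simple_function {T : Type} (f : R -> T) : Prop :=
  finite_set (range f) /\
  forall c : T, measurable (f @^-1` [set c] : set (measurableTypeR R)).

(* Bochner measurability; no separability of H is assumed. *)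
Definition strongly_measurable {H : hilbertType R} (D : set R) (f : R -> H) :
    Prop :=
  exists g : nat -> R -> H,
    (forall n, simple_function (g n)) /\
    {ae mu, forall s, D s -> g n s @[n --> \oo] --> f s}.

Definition L2on {H : hilbertType R} (D : set R) (f : R -> H) : Prop :=
  strongly_measurable D f /\
  (\int[mu]_(s in D) (hnorm (f s) ^+ 2)%:E < +oo)%E.

Definition L2 {H : hilbertType R} (f : R -> H) : Prop := L2on `]0, +oo[ f.

Definition L2loc {H : hilbertType R} (f : R -> H) : Prop :=
  forall tau : R, 0 < tau -> L2on `]0, tau[ f.

Definition L2norm {H : hilbertType R} (f : R -> H) : R :=
  Num.sqrt (\int[mu]_(s in `]0, +oo[) (hnorm (f s) ^+ 2)).

Definition Linfty {H : hilbertType R} (f : R -> H) : Prop :=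
  strongly_measurable `]0, +oo[ f /\
  exists M : R, {ae mu, forall s, 0 < s -> hnorm (f s) <= M}.

Definition trunc {H : hilbertType R} (tau : R) (f : R -> H) : R -> H :=
  fun s => if 0 <= s <= tau then f s else 0.

Definition concat {T : Type} (tau : R) (f g : R -> T) : R -> T :=
  fun s => if s < tau then f s else g (s - tau).

End FunctionSpaces.

(* The time index is constrained to [0, oo) by the axioms.  Boundedness and
   linearity force the maps on L2 to be compatible with a.e. equality. *)
Record wp_system (R : realType) (U X Y : hilbertType R) := WPSystem {
  sgT : R -> {linear X -> X} ;
  inPhi : R -> (R -> U) -> X ;
  outPsi : R -> X -> (R -> Y) ;
  ioF : R -> (R -> U) -> (R -> Y) ;
  sgT_continuous : forall t : R, 0 <= t -> continuous (sgT t) ;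
  inPhi_linear : forall (t : R) (a : R[i]) (u v : R -> U),
    0 <= t -> L2 u -> L2 v ->
    inPhi t (fun s => a *: u s + v s) = a *: inPhi t u + inPhi t v ;
  inPhi_bounded : forall t : R, 0 <= t ->
    exists M : R, forall u, L2 u -> hnorm (inPhi t u) <= M * L2norm u ;
  outPsi_L2 : forall (t : R) (x : X), 0 <= t -> L2 (outPsi t x) ;
  outPsi_linear : forall (t : R) (a : R[i]) (x z : X), 0 <= t ->
    ae_eq_pos (outPsi t (a *: x + z))
              (fun s => a *: outPsi t x s + outPsi t z s) ;
  outPsi_bounded : forall t : R, 0 <= t ->
    exists M : R, forall x, L2norm (outPsi t x) <= M * hnorm x ;
  ioF_L2 : forall (t : R) (u : R -> U), 0 <= t -> L2 u -> L2 (ioF t u) ;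
  ioF_linear : forall (t : R) (a : R[i]) (u v : R -> U),
    0 <= t -> L2 u -> L2 v ->
    ae_eq_pos (ioF t (fun s => a *: u s + v s))
              (fun s => a *: ioF t u s + ioF t v s) ;
  ioF_bounded : forall t : R, 0 <= t ->
    exists M : R, forall u, L2 u -> L2norm (ioF t u) <= M * L2norm u ;
  sgT0 : forall x : X, sgT 0 x = x ;
  sgTD : forall (t tau : R) (x : X), 0 <= t -> 0 <= tau ->
    sgT (tau + t) x = sgT t (sgT tau x) ;
  sgT_strong : forall x : X, sgT t x @[t --> 0^'+] --> x ;
  outPsi0 : forall x : X, ae_eq_pos (outPsi 0 x) (fun=> 0) ;
  ioF0 : forall u : R -> U, L2 u -> ae_eq_pos (ioF 0 u) (fun=> 0) ;
  inPhiD : forall (t tau : R) (u v : R -> U),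
    0 <= t -> 0 <= tau -> L2 u -> L2 v ->
    inPhi (tau + t) (concat tau u v) = sgT t (inPhi tau u) + inPhi t v ;
  outPsiD : forall (t tau : R) (x : X), 0 <= t -> 0 <= tau ->
    ae_eq_pos (outPsi (tau + t) x)
              (concat tau (outPsi tau x) (outPsi t (sgT tau x))) ;
  ioFD : forall (t tau : R) (u v : R -> U),
    0 <= t -> 0 <= tau -> L2 u -> L2 v ->
    ae_eq_pos (ioF (tau + t) (concat tau u v))
      (concat tau (ioF tau u)
                  (fun s => outPsi t (inPhi tau u) s + ioF t v s))
}.

Section Trajectories.
Context {R : realType} {U X Y : hilbertType R}.
Implicit Types S : wp_system U X Y.

(* The maps Psi_oo and F_oo are selected by the property determining them:
   P_t Psi_oo = Psi_t and P_t F_oo = F_t P_t for all t >= 0. *)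
Definition outPsi_oo S (x0 : X) : R -> Y :=
  xget (fun=> 0) [set y : R -> Y | L2loc y /\
    forall t, 0 <= t -> ae_eq_pos (trunc t y) (outPsi S t x0)].

Definition ioF_oo S (u : R -> U) : R -> Y :=
  xget (fun=> 0) [set y : R -> Y | L2loc y /\
    forall t, 0 <= t -> ae_eq_pos (trunc t y) (ioF S t (trunc t u))].

Definition mild_state S (x0 : X) (u : R -> U) : R -> X :=
  fun t => sgT S t x0 + inPhi S t (trunc t u).

Definition mild_output S (x0 : X) (u : R -> U) : R -> Y :=
  fun s => outPsi_oo S x0 s + ioF_oo S u s.

Definition mild_solution S (x0 : X) (u : R -> U) (x : R -> X) (y : R -> Y) :
    Prop :=
  (forall t, 0 <= t -> x t = mild_state S x0 u t) /\
  ae_eq_pos y (mild_output S x0 u).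

Definition strongly_stable S : Prop :=
  forall x0 : X, sgT S t x0 @[t --> +oo] --> (0 : X).

End Trajectories.

Section Feedback.
Context {R : realType} {U X : hilbertType R}.
Implicit Types S K : wp_system U X U.

Definition impedance_passive S : Prop :=
  forall (x0 : X) (u : R -> U), L2loc u -> forall t : R, 0 <= t ->
    hnorm (mild_state S x0 u t) ^+ 2 - hnorm x0 ^+ 2 <=
    2 * \int[lebesgue_measure]_(s in `[0, t])
          inner_re (u s) (mild_output S x0 u s).

Definition feedback_solution S (x0 : X) (v : R -> U) (x : R -> X)
    (y : R -> U) : Prop :=
  L2loc y /\ mild_solution S x0 (fun s => v s - y s) x y.

Definition negative_feedback S K : Prop :=
  forall (x0 : X) (v : R -> U), L2loc v ->
    feedback_solution S x0 v (mild_state K x0 v) (mild_output K x0 v) /\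
    forall (x : R -> X) (y : R -> U), feedback_solution S x0 v x y ->
      (forall t, 0 <= t -> x t = mild_state K x0 v t) /\
      ae_eq_pos y (mild_output K x0 v).

(* Lipschitz on bounded sets.  For infinite-dimensional U this is stronger
   than being Lipschitz near every point, and it is what makes phi(-y)
   locally square integrable for essentially bounded y. *)
Definition locally_lipschitz (phi : U -> U) : Prop :=
  forall r : R, exists L : R, forall u v : U, hnorm u <= r -> hnorm v <= r ->
    hnorm (phi u - phi v) <= L * hnorm (u - v).

(* Solutions of the system closed by the nonlinear feedback u = phi(-y). *)
Definition nonlinear_solution S (phi : U -> U) (x0 : X) (x : R -> X)
    (y : R -> U) : Prop :=
  [/\ {within `[0, +oo[, continuous x}, Linfty y &
      mild_solution S x0 (fun s => phi (- y s)) x y].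

Definition stable_solution (phi : U -> U) (x : R -> X) (y : R -> U) : Prop :=
  [/\ x t @[t --> +oo] --> (0 : X), L2 y & L2 (fun s => phi (- y s))].

End Feedback.

(* Main.v *)
Require Import Defs.
From mathcomp Require Import all_boot all_order all_algebra complex.
From mathcomp Require Import all_classical all_reals all_analysis.
From mathcomp Require Import measurable_realfun.
From mathcomp Require Import lra ring.

(** Along a solution of the nonlinear loop the input is [u = phi (- y)], so the
power supplied to the passive system is [- Re <phi (- y), - y>].  Since [y] is
essentially bounded, the two damping conditions combine into one quadratic
estimate [Re <phi w, w> >= c |w|^2] on the range of [w = - y]
([damping_coercive]).  Passivity then says that [c] times the energy of [y]
over [0, t] is at most [|x0|^2 / 2] for every [t]; hence [y] is in L2, and so
is [phi (- y)], because [phi] is Lipschitz on bounded sets and vanishes at [0]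
([nonlinear_solution_L2]).

Put [v = phi (- y) + y], which is in L2.  Then [phi (- y) = v - y], so [(x, y)]
also solves the linear feedback loop with external input [v], and by uniqueness
[x] is the state of the feedback system driven by [v].  It remains to see that
this state vanishes for every square integrable [v]
([feedback_state_vanishes]).  By passivity and [4 Re <v - y, y> <= |v|^2], the
state reached from rest is bounded by the L2 norm of [v], uniformly in time
([feedback_state_bound]).  Splitting [v] at a late time [tau]
([mild_state_split]), the state at [t] is the free evolution over [t - tau] of
the state at [tau], which tends to [0] by strong stability, plus the response
from rest to the tail of [v], which is small uniformly in [t].

The measure theory has one subtlety: signals are almost everywhere limits of
simple functions, so their squared norms need not be Borel.  The integral of a
nonnegative function is a lower integral, for which almost everywhere
comparison holds with no measurability at all ([le_integral_ae]); where
additivity, homogeneity or monotone convergence is needed, energies are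
computed on a Borel representative ([strongly_measurable_sqr]). *)

Set Implicit Arguments.
Unset Strict Implicit.
Unset Printing Implicit Defensive.

Import Order.TTheory GRing.Theory Num.Theory.
Import numFieldNormedType.Exports.

Local Open Scope classical_set_scope.
Local Open Scope ring_scope.

(** * Real-valued norm and inner product *)

Section Hilbert.
Context {R : realType} {H : hilbertType R}.
Implicit Types a b : H.

Lemma normr_hnorm a : `|a| = (hnorm a)%:C%C :> R[i].
Proof.
have := normr_ge0 a; rewrite lecE /hnorm => /andP[/eqP/=].
by case: (`|a|) => r i /= -> _.
Qed.

Lemma hnorm_ge0 a : 0 <= hnorm a.
Proof. by have := normr_ge0 a; rewrite normr_hnorm lecR. Qed.

Lemma hnorm0 : hnorm (0 : H) = 0.
Proof. by rewrite /hnorm normr0. Qed.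

Lemma hnorm_opp a : hnorm (- a) = hnorm a.
Proof. by rewrite /hnorm normrN. Qed.

Lemma ler_hnormD a b : hnorm (a + b) <= hnorm a + hnorm b.
Proof. by have := ler_normD a b; rewrite !normr_hnorm -rmorphD lecR. Qed.

Lemma inner_reDl a b c : inner_re (a + b) c = inner_re a c + inner_re b c.
Proof. by rewrite /inner_re linearDl /= raddfD. Qed.

Lemma inner_reDr a b c : inner_re a (b + c) = inner_re a b + inner_re a c.
Proof. by rewrite /inner_re linearDr /= raddfD. Qed.

Lemma inner_reNl a b : inner_re (- a) b = - inner_re a b.
Proof. by rewrite /inner_re linearNl /= raddfN. Qed.

Lemma inner_reNr a b : inner_re a (- b) = - inner_re a b.
Proof. by rewrite /inner_re linearNr /= raddfN. Qed.

Lemma inner_reC a b : inner_re a b = inner_re b a.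
Proof.
rewrite /inner_re (hermC inner a b) expr0 mul1r.
by rewrite /=; case: (inner b a : R[i]).
Qed.

Lemma hnorm_sqr a : hnorm a ^+ 2 = inner_re a a.
Proof.
by rewrite /inner_re -sqr_normr_inner normr_hnorm -rmorphXn.
Qed.

Lemma hnormD_sqr a b :
  hnorm (a + b) ^+ 2 = hnorm a ^+ 2 + 2 * inner_re a b + hnorm b ^+ 2.
Proof.
rewrite !hnorm_sqr inner_reDl !inner_reDr [inner_re b a]inner_reC; ring.
Qed.

Lemma hnormD_sqr_le a b :
  hnorm (a + b) ^+ 2 <= 2 * hnorm a ^+ 2 + 2 * hnorm b ^+ 2.
Proof.
rewrite hnormD_sqr; have := sqr_ge0 (hnorm (a - b)).
rewrite hnormD_sqr inner_reNr hnorm_opp; lra.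
Qed.

Lemma inner_re_le a b : 2 * inner_re a b <= hnorm a ^+ 2 + hnorm b ^+ 2.
Proof.
have := sqr_ge0 (hnorm (a - b)).
rewrite hnormD_sqr inner_reNr hnorm_opp; lra.
Qed.

(** This is [0 <= |a - 2b|^2] expanded.  With [a] the external input and [b]
the output, it says that under negative feedback the supplied power is
controlled by the external input alone, whatever the output is. *)
Lemma inner_re_feedback_le a b : 4 * inner_re (a - b) b <= hnorm a ^+ 2.
Proof.
have := sqr_ge0 (hnorm (a - (b + b))).
rewrite hnormD_sqr hnorm_opp hnormD_sqr inner_reNr inner_reDr.
rewrite inner_reDl inner_reNl -!hnorm_sqr; lra.
Qed.

(** Norms in [H] take values in [R[i]], so convergence is defined with complex
radii; a positive complex number is real, hence real radii suffice. *)
Lemma cvg_hnormP {T : Type} {F : set_system T} {FF : Filter F} (f : T -> H) l :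
  f @ F --> l <-> forall e : R, 0 < e -> \forall t \near F, hnorm (f t - l) < e.
Proof.
split=> [/cvgrPdistC_lt fl e e0|fl].
  have := fl e%:C%C; rewrite ltcR => /(_ e0); apply: filterS => t.
  by rewrite normr_hnorm ltcR.
apply/cvgrPdistC_lt => -[e i]; rewrite ltcE /= => /andP[/eqP-> e0].
by have := fl e e0; apply: filterS => t; rewrite normr_hnorm ltcR.
Qed.

Lemma cvg_hnorm {T : Type} {F : set_system T} {FF : Filter F} (f : T -> H) l :
  f @ F --> l -> hnorm (f t) @[t --> F] --> hnorm l.
Proof.
move=> /cvg_hnormP fl; apply/cvgrPdistC_lt => e e0.
have := fl e e0; apply: filterS => t; apply: le_lt_trans.
rewrite ler_norml lerBrDr -[X in _ && X]lerBrDr; apply/andP; split.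
  have := ler_hnormD (l - f t) (f t); rewrite subrK -(hnorm_opp (l - f t)) opprB; lra.
have := ler_hnormD (f t - l) l; rewrite subrK; lra.
Qed.

End Hilbert.

(** * Lower integrals and strong measurability *)

Section LowerIntegral.
Context d (T : measurableType d) (R : realType).
Variable mu : {measure set T -> \bar R}.
Local Open Scope ereal_scope.
Import HBNNSimple.

(** The integral of a nonnegative function is the supremum of the integrals of
the simple functions below it.  A simple function below [f] falls below [g]
once it is set to zero on the exceptional null set, and this does not change
its integral; so the comparison holds without any measurability, and for
different domains.  This matters because squared norms of strongly measurable
functions are Borel only up to null sets. *)
Lemma le_integral_ae (D E : set T) (f g : T -> \bar R) :
  (forall x, 0 <= f x) -> (forall x, 0 <= g x) ->
  {ae mu, forall x, D x -> f x = 0 \/ E x /\ f x <= g x} ->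
  \int[mu]_(x in D) f x <= \int[mu]_(x in E) g x.
Proof.
move=> f0 g0 [N [mN N0 sub]]; rewrite integral_mkcond [leRHS]integral_mkcond.
have fD0 x : 0 <= (f \_ D) x by apply: erestrict_ge0.
have gE0 x : 0 <= (g \_ E) x by apply: erestrict_ge0.
rewrite ge0_integralTE// [leRHS]ge0_integralTE//.
apply: ge_ereal_sup => _ [h hf <-].
have mh A : measurable_fun A (EFin \o h : T -> \bar R).
  exact/measurable_EFinP/measurable_funTS.
have mNC : measurable (setT `\` N) by exact: measurableD.
have -> : sintegral mu h = \int[mu]_(x in setT `\` N) (h x)%:E.
  rewrite -(ge0_negligible_integral mN)//.
    by rewrite integral_nnsfun// patch_setT.
  by move=> x _; rewrite lee_fin; exact: fun_ge0.
rewrite integral_mkcond.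
have -> : (fun x => ((EFin \o h) \_ (setT `\` N)) x) =
    EFin \o (proj_nnsfun h mNC).
  apply/funext => x; rewrite /= mindicE patchE.
  by case: ifPn; rewrite ?mulr1 ?mulr0.
rewrite integral_nnsfun// patch_setT; apply: ereal_sup_ubound.
exists (proj_nnsfun h mNC) => // x; rewrite /= mindicE.
case: (boolP (x \in _)) => [|_]; rewrite ?mulr0//= mulr1 inE => -[_ Nx].
apply: le_trans (hf x) _; rewrite /patch.
have P : D x -> f x = 0 \/ E x /\ f x <= g x.
  by apply: contrapT => nP; apply: Nx; exact: sub.
case: ifPn => [|_]; last by case: ifPn.
rewrite inE => /P[->|[Ex fg]]; first by case: ifPn.
by rewrite mem_set.
Qed.

End LowerIntegral.

Section StrongMeasurability.
Context {R : realType}.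
Local Notation mu := (@lebesgue_measure R).

(** Lebesgue measure lives on an alias of [R] that carries the Borel
sigma-algebra; these instances of [filterS] and [filterS2] take predicates on
[R] itself. *)
Lemma ae_imply (P Q : R -> Prop) : (forall s, P s -> Q s) ->
  {ae mu, forall s, P s} -> {ae mu, forall s, Q s}.
Proof. by move=> PQ; apply: (@filterS (measurableTypeR R)). Qed.

Lemma ae_imply2 (P Q S : R -> Prop) : (forall s, P s -> Q s -> S s) ->
  {ae mu, forall s, P s} -> {ae mu, forall s, Q s} -> {ae mu, forall s, S s}.
Proof. by move=> PQ; apply: (@filterS2 (measurableTypeR R)). Qed.

Lemma simple_function_comp {S T : Type} (F : S -> T) (f : R -> S) :
  simple_function f -> simple_function (fun s => F (f s)).
Proof.
move=> [ff mf]; split.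
  apply: sub_finite_set (finite_image F ff) => _ [s _ <-].
  by exists (f s) => //; exists s.
move=> c; rewrite (_ : _ @^-1` _ =
    \bigcup_(a in range f `&` [set a | F a = c]) (f @^-1` [set a])).
  by apply: fin_bigcup_measurable => //; exact: finite_setIl.
apply/seteqP; split=> s /= => [Fc|[a [_ <-]] ->//].
by exists (f s) => //; split => //; exists s.
Qed.

Lemma simple_function_pair {S T : Type} (f : R -> S) (g : R -> T) :
  simple_function f -> simple_function g ->
  simple_function (fun s => (f s, g s)).
Proof.
move=> [ff mf] [fg mg]; split.
  apply: sub_finite_set (finite_setX ff fg) => _ [s _ <-].
  by split; exists s.
move=> [a b]; rewrite (_ : _ @^-1` _ = f @^-1` [set a] `&` g @^-1` [set b]).
  exact: measurableI.
by apply/seteqP; split=> s /= [-> ->].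
Qed.

Lemma simple_function_pred (p : pred R) :
  measurable ([set s | p s] : set (measurableTypeR R)) -> simple_function p.
Proof.
move=> mp; split; first exact: finite_finset.
have pE : p @^-1` [set true] = [set s | p s] by [].
case; first by rewrite pE.
rewrite (_ : p @^-1` _ = ~` [set s | p s]); first exact: measurableC.
by apply/seteqP; split=> s /=; case: (p s).
Qed.

Lemma simple_function_measurable (f : R -> R) : simple_function f ->
  measurable_fun setT (f : measurableTypeR R -> measurableTypeR R).
Proof.
move=> [ff mf] _ B _; rewrite setTI (_ : f @^-1` B =
    \bigcup_(a in range f `&` B) (f @^-1` [set a])).
  by apply: fin_bigcup_measurable => //; exact: finite_setIl.
apply/seteqP; split=> s /= => [Bf|[a [_ Ba] /= ->] //].
by exists (f s) => //; split => //; exists s.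
Qed.

Definition cutoff {H : hilbertType R} (p : pred R) (f : R -> H) : R -> H :=
  fun s => if p s then f s else 0.

Section Values.
Context {H : hilbertType R}.
Implicit Types (D E : set R) (f g : R -> H).

Lemma strongly_measurable_ae D E f g : strongly_measurable D f ->
  {ae mu, forall s, E s -> D s /\ f s = g s} -> strongly_measurable E g.
Proof.
move=> [h [sh hf]] fg; exists h; split => //.
by apply: ae_imply2 hf fg => s hf fg /fg[/hf + <-].
Qed.

Lemma strongly_measurable_cutoff D E f (p : pred R) :
  measurable ([set s | p s] : set (measurableTypeR R)) ->
  strongly_measurable D f -> {ae mu, forall s, E s -> p s -> D s} ->
  strongly_measurable E (cutoff p f).
Proof.
move=> mp [h [sh hf]] ED; exists (fun n => cutoff p (h n)); split.
  move=> n; rewrite /cutoff.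
  have := simple_function_pair (simple_function_pred mp) (sh n).
  exact: (@simple_function_comp _ _ (fun bx : bool * H => if bx.1 then bx.2 else 0)).
apply: ae_imply2 hf ED => s hf ED Es; rewrite /cutoff.
by case: ifPn => [ps|_]; [exact/hf/ED|exact: cvg_cst].
Qed.

Lemma strongly_measurable_comp D f (F : H -> H) : continuous F ->
  strongly_measurable D f -> strongly_measurable D (fun s => F (f s)).
Proof.
move=> cF [h [sh hf]]; exists (fun n s => F (h n s)); split.
  by move=> n; apply: simple_function_comp.
by apply: ae_imply hf => s hf /hf; apply: continuous_cvg; exact: cF.
Qed.

Lemma strongly_measurableD D f g :
  strongly_measurable D f -> strongly_measurable D g ->
  strongly_measurable D (fun s => f s + g s).
Proof.
move=> [h [sh hf]] [k [sk kg]]; exists (fun n s => h n s + k n s); split.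
  move=> n; have := simple_function_pair (sh n) (sk n).
  exact: (@simple_function_comp _ _ (fun xy : H * H => xy.1 + xy.2)).
by apply: ae_imply2 hf kg => s hf kg Ds; apply: cvgD; [exact: hf|exact: kg].
Qed.

(** The representative is the limit superior of the squared norms of the simple
approximations: it is Borel on the whole line, also where these diverge.
Through it the additivity, homogeneity and continuity properties of the
integral, which need measurable integrands, become available for energies. *)
Lemma strongly_measurable_sqr D f : strongly_measurable D f ->
  exists G : R -> \bar R,
    [/\ measurable_fun setT (G : measurableTypeR R -> \bar R),
        forall s, (0 <= G s)%E &
        {ae mu, forall s, D s -> (hnorm (f s) ^+ 2)%:E = G s}].
Proof.
move=> [h [sh hf]].
pose L (s : measurableTypeR R) := limn_esup (fun n => (hnorm (h n s) ^+ 2)%:E).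
exists (fun s => `|L s|)%E; split => //.
  apply: (measurableT_comp (@abse_measurable R setT)).
  apply: measurable_fun_limn_esup => n.
  have mh : measurable_fun setT
      (fun s : measurableTypeR R => hnorm (h n s) ^+ 2 : measurableTypeR R).
    apply: simple_function_measurable.
    exact: (@simple_function_comp _ _ (fun x : H => hnorm x ^+ 2)).
  exact/measurable_EFinP.
apply: ae_imply hf => s hf Ds.
suff : (hnorm (h n s) ^+ 2)%:E @[n --> \oo] --> (hnorm (f s) ^+ 2)%:E.
  move=> hl; rewrite /L is_cvg_limn_esupE; last by apply/cvg_ex; eexists; exact: hl.
  by rewrite (cvg_lim _ hl)// gee0_abs// lee_fin sqr_ge0.
apply: cvg_EFin; first by near=> n.
rewrite /=; under eq_fun do rewrite /= expr2.
by rewrite expr2; apply: cvgM; apply: cvg_hnorm; exact: hf.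
Unshelve. all: by end_near. Qed.

End Values.
End StrongMeasurability.

(** * Square integrable signals *)

Section SquareIntegrable.
Context {R : realType} {H : hilbertType R}.
Local Notation mu := (@lebesgue_measure R).
Implicit Types (D E : set R) (f g : R -> H).

Lemma energyE D f (G : R -> \bar R) :
  (forall s, 0 <= G s)%E ->
  {ae mu, forall s, D s -> (hnorm (f s) ^+ 2)%:E = G s} ->
  (\int[mu]_(s in D) (hnorm (f s) ^+ 2)%:E = \int[mu]_(s in D) G s)%E.
Proof.
move=> G0 fG; apply/eqP; rewrite eq_le; apply/andP; split.
- apply: le_integral_ae => // [s|]; first by rewrite lee_fin sqr_ge0.
  by apply: ae_imply fG => s fG Ds; right; rewrite fG.
- apply: le_integral_ae => // [s|]; first by rewrite lee_fin sqr_ge0.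
  by apply: ae_imply fG => s fG Ds; right; rewrite fG.
Qed.

Lemma energyZ D f (c : R) :
  measurable (D : set (measurableTypeR R)) -> 0 <= c -> strongly_measurable D f ->
  (\int[mu]_(s in D) (c * hnorm (f s) ^+ 2)%:E =
   c%:E * \int[mu]_(s in D) (hnorm (f s) ^+ 2)%:E)%E.
Proof.
move=> mD c0 mf; have [G [mG G0 fG]] := strongly_measurable_sqr mf.
rewrite (energyE G0 fG) -ge0_integralZl_EFin//; last exact: measurable_funTS.
have c0s s : (0 <= c%:E * G s)%E by rewrite mule_ge0// lee_fin.
have c0f s : (0 <= (c * hnorm (f s) ^+ 2)%:E)%E by rewrite lee_fin mulr_ge0// sqr_ge0.
apply/eqP; rewrite eq_le; apply/andP; split; apply: le_integral_ae => //;
by apply: ae_imply fG => s fG Ds; right; rewrite -fG// EFinM.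
Qed.

Lemma L2on_dominated D E f g (c : R) : measurable (D : set (measurableTypeR R)) ->
  0 <= c -> L2on D f -> strongly_measurable E g ->
  {ae mu, forall s, E s ->
    g s = 0 \/ D s /\ hnorm (g s) ^+ 2 <= c * hnorm (f s) ^+ 2} ->
  L2on E g.
Proof.
move=> mD c0 [mf finf] mg gf; split => //.
have [G [mG G0 fG]] := strongly_measurable_sqr mf.
apply: (@le_lt_trans _ _ (\int[mu]_(s in D) (c%:E * G s)))%E.
  apply: le_integral_ae => [s|s|]; first by rewrite lee_fin sqr_ge0.
    by rewrite mule_ge0// lee_fin.
  apply: ae_imply2 gf fG => s gf fG /gf[->|[Ds le]].
    by left; rewrite hnorm0 expr0n.
  by right; split => //; rewrite -fG// -EFinM lee_fin.
rewrite ge0_integralZl_EFin//; last exact: measurable_funTS.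
by rewrite -(energyE G0 fG) lte_mul_pinfty.
Qed.

Lemma L2onD D f g : measurable (D : set (measurableTypeR R)) ->
  L2on D f -> L2on D g -> L2on D (fun s => f s + g s).
Proof.
move=> mD [mf finf] [mg fing]; split; first exact: strongly_measurableD.
have [F [mF F0 fF]] := strongly_measurable_sqr mf.
have [G [mG G0 gG]] := strongly_measurable_sqr mg.
apply: (@le_lt_trans _ _ (\int[mu]_(s in D) (2%:E * (F s + G s))))%E.
  apply: le_integral_ae => [s|s|]; first by rewrite lee_fin sqr_ge0.
    by rewrite mule_ge0// ?adde_ge0// lee_fin.
  apply: ae_imply2 fF gG => s fF gG Ds; right; split => //.
  rewrite -fF// -gG// -EFinD -EFinM lee_fin mulrDr; exact: hnormD_sqr_le.
rewrite ge0_integralZl_EFin//; last first.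
- by apply: measurable_funTS; exact: emeasurable_funD.
- by move=> s _; exact: adde_ge0.
rewrite ge0_integralD//; try exact: measurable_funTS.
rewrite -(energyE F0 fF) -(energyE G0 gG) lte_mul_pinfty//.
exact: lte_add_pinfty.
Qed.

Lemma L2on_cutoff D E f (p : pred R) : measurable (D : set (measurableTypeR R)) ->
  measurable ([set s | p s] : set (measurableTypeR R)) -> L2on D f ->
  {ae mu, forall s, E s -> p s -> D s} -> L2on E (cutoff p f).
Proof.
move=> mD mp Df ED; apply: (L2on_dominated (D := D) (f := f) (c := 1)) => //.
  by apply: strongly_measurable_cutoff ED => //; case: Df.
apply: ae_imply ED => s ED Es; rewrite /cutoff; case: ifPn => ps; last by left.
by right; split; [exact: ED|rewrite mul1r].
Qed.

Lemma L2on_subset D E f : measurable (D : set (measurableTypeR R)) ->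
  E `<=` D -> L2on D f -> L2on E f.
Proof.
move=> mD ED Df; apply: (L2on_dominated (D := D) (f := f) (c := 1)) => //.
  case: Df => + _; move/strongly_measurable_ae; apply.
  by apply: (aeW mu) => s /ED.
by apply: (aeW mu) => s /ED; right; split => //; rewrite mul1r.
Qed.

Lemma L2_L2loc f : L2 f -> L2loc f.
Proof.
move=> f2 t t0; apply: L2on_subset f2; first exact: measurable_itv.
by move=> s /=; rewrite !in_itv /= andbT => /andP[].
Qed.

Lemma bounded_L2loc f (M : R) : strongly_measurable `]0%R, +oo[ f ->
  {ae mu, forall s, 0 < s -> hnorm (f s) <= M} -> L2loc f.
Proof.
move=> mf fM t t0; split.
  apply: strongly_measurable_ae mf _; apply: (aeW mu) => s /=.
  by rewrite !in_itv /= andbT => /andP[].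
apply: (@le_lt_trans _ _ (\int[mu]_(s in `]0%R, t[) (M ^+ 2)%:E))%E.
  apply: le_integral_ae => [s|s|]; try by rewrite lee_fin sqr_ge0.
  apply: ae_imply fM => s fM; rewrite /= in_itv /= => /andP[s0 st].
  right; split; first by rewrite s0.
  by rewrite lee_fin ler_pXn2r// ?nnegrE ?hnorm_ge0 ?(le_trans (hnorm_ge0 _) (fM s0)) ?fM.
rewrite integral_cst//=.
by rewrite lebesgue_measure_itv /= lte_fin t0 sube0 -EFinM ltry.
Qed.

Lemma integral_exhaust (G : R -> \bar R) :
  measurable_fun setT (G : measurableTypeR R -> \bar R) ->
  (forall s, 0 <= G s)%E ->
  (\int[mu]_(s in `]0%R, n%:R[) G s @[n --> \oo] -->
   \int[mu]_(s in `]0%R, +oo[) G s)%E.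
Proof.
move=> mG G0.
have <- : \bigcup_n `]0%R, n%:R[%classic = `]0%R, +oo[%classic :> set R.
  apply/seteqP; split=> s /=; first by case=> n _ /=; rewrite !in_itv/= andbT => /andP[].
  rewrite in_itv/= andbT => s0; exists (Num.bound s) => //=.
  by rewrite in_itv/= s0; have := archi_boundP (ltW s0).
apply: ge0_nondecreasing_set_cvg_integral => // [m n mn|n].
- rewrite subsetEset => s /=; rewrite !in_itv/= => /andP[-> /lt_le_trans]; apply.
  by rewrite ler_nat.
- exact: measurable_funTS.
Qed.

(** The weight [c] stays inside the integral so that the hypothesis can come
from a pointwise comparison with an integrand dominating [c |f|^2]. *)
Lemma L2_of_bounded_energy f (c C : R) :
  0 < c -> strongly_measurable `]0, +oo[ f ->
  (forall t : R, 0 < t ->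
     (\int[mu]_(s in `]0%R, t[) (c * hnorm (f s) ^+ 2)%:E <= C%:E)%E) -> L2 f.
Proof.
move=> c0 mf fC; split => //; have [G [mG G0 fG]] := strongly_measurable_sqr mf.
rewrite (energyE G0 fG); apply: (@le_lt_trans _ _ (C / c)%:E); last exact: ltry.
have Gcvg := integral_exhaust mG G0.
rewrite -(cvg_lim _ Gcvg)//; apply: lime_le.
  by apply/cvg_ex; eexists; exact: Gcvg.
near=> n; have n0 : (0 < n%:R :> R) by rewrite ltr0n; near: n; exact: nbhs_infty_gt.
have sub s : `]0, n%:R[%classic s -> `]0, +oo[%classic s.
  by rewrite /= !in_itv/= andbT => /andP[].
rewrite -(@energyE _ f)//; last by apply: ae_imply fG => s fG /sub.
rewrite EFinM muleC lee_pdivlMl// -energyZ ?(ltW c0)//; first exact: fC.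
by apply: strongly_measurable_ae mf _; apply: (aeW mu) => s /sub.
Unshelve. all: by end_near. Qed.

(** Truncating the past instead of translating the signal keeps the tail
estimate free of a change of variables. *)
Lemma L2_tail f (e : R) : L2 f -> 0 < e -> exists t : R, 0 < t /\
  (\int[mu]_(s in `]0%R, +oo[) (hnorm (cutoff (fun s => t <= s)%R f s) ^+ 2)%:E
     < e%:E)%E.
Proof.
move=> [mf finf] e0; have [G [mG G0 fG]] := strongly_measurable_sqr mf.
rewrite (energyE G0 fG) in finf.
have Gcvg := integral_exhaust mG G0.
set I := (\int[mu]_(s in `]0%R, +oo[) G s)%E in finf Gcvg.
have I0 : (0 <= I)%E by exact: integral_ge0.
have Ifin : I \is a fin_num by rewrite ge0_fin_numE.
have [n [n0 nI]] : exists n : nat, (0 < n)%N /\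
    (I - e%:E < \int[mu]_(s in `]0%R, n%:R[) G s)%E.
  have : \forall n \near \oo, (I - e%:E < \int[mu]_(s in `]0%R, n%:R[) G s)%E.
    have IeI : (I - e%:E < I)%E by rewrite lteBlDr// lteDl.
    exact: (Gcvg _ (open_ereal_gt' IeI)).
  move=> In; near \oo => n; exists n; split; last by near: n.
  by near: n; exact: nbhs_infty_gt.
exists n%:R; split; first by rewrite ltr0n.
apply: (@le_lt_trans _ _ (\int[mu]_(s in `[n%:R, +oo[) G s))%E.
  apply: le_integral_ae => // [s|]; first by rewrite lee_fin sqr_ge0.
  apply: ae_imply fG => s fG s0; rewrite /cutoff.
  case: ifPn => ns; last by left; rewrite hnorm0 expr0n.
  by right; rewrite -fG//; split => //=; rewrite in_itv/= ns.
have split_I : (I = \int[mu]_(s in `]0%R, n%:R[) G s +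
                    \int[mu]_(s in `[n%:R, +oo[) G s)%E.
  rewrite -ge0_integral_setU//.
  - rewrite /I; congr (integral _ _ _); apply/seteqP; split=> s /=.
      by rewrite !in_itv/= !andbT => -> /=; case: ltP; [left|right].
    rewrite !in_itv/= !andbT => -[/andP[]//|]; apply: lt_le_trans.
    by rewrite ltr0n.
  - exact: measurable_funTS.
  - apply/disj_setPS => s /= []; rewrite !in_itv/= andbT => /andP[_ /lt_le_trans].
    by move=> /[apply]; rewrite ltxx.
have fin1 : (\int[mu]_(s in `]0%R, n%:R[) G s)%E \is a fin_num.
  rewrite ge0_fin_numE ?integral_ge0//; apply: le_lt_trans finf.
  by rewrite split_I leeDl// integral_ge0.
by move: nI; rewrite split_I lteBlDr// lteD2lE.
Unshelve. all: by end_near. Qed.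

End SquareIntegrable.

(** * Integral inequalities for signed functions, and the nonlinearity *)

Section RealIntegrals.
Context {R : realType}.
Local Notation mu := (@lebesgue_measure R).
Implicit Types (D E : set R) (f g : R -> R).

(** An upper bound by a nonnegative function is immune to the conventions of
the real-valued integral: only the positive part of [f] matters, and an
infinite integral of [f] makes the left side [0]. *)
Lemma Rintegral_le_lower D E f g : (forall s, 0 <= g s) ->
  {ae mu, forall s, D s -> f s <= 0 \/ E s /\ f s <= g s} ->
  ((\int[mu]_(s in D) f s)%:E <= \int[mu]_(s in E) (g s)%:E)%E.
Proof.
move=> g0 fg; have g0E : (0 <= \int[mu]_(s in E) (g s)%:E)%E.
  by apply: integral_ge0 => s _; rewrite lee_fin.
have fgE : (\int[mu]_(s in D) (f s)%:E <= \int[mu]_(s in E) (g s)%:E)%E.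
  rewrite integralE; set P := (X in (X - _)%E); set N := (X in (_ - X)%E).
  apply: (@le_trans _ _ P).
    by rewrite -[leRHS]sube0; apply: leeB => //; apply: integral_ge0.
  apply: le_integral_ae => [s|s|]; [exact: funepos_ge0|by rewrite lee_fin|].
  apply: ae_imply fg => s fg /fg; rewrite funeposE => -[f0|[Es fgs]].
    by left; rewrite -EFin_max max_r.
  by right; split => //; rewrite -EFin_max lee_fin ge_max fgs g0.
by rewrite /Rintegral; case: (integral _ _ _) fgE => [r| |] //=.
Qed.

(** A lower bound on the dissipated amount [- f] is not immune to them: without
the upper bound [M], the integral of [f] could be [-oo] and its real value
[0]. *)
Lemma Rintegral_le0_ge D E f g (M : R) : measurable (D : set (measurableTypeR R)) ->
  (mu D < +oo)%E -> (forall s, 0 <= g s) -> 0 <= M ->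
  {ae mu, forall s, D s -> f s <= 0 /\ - f s <= M} ->
  {ae mu, forall s, E s -> D s /\ g s <= - f s} ->
  (\int[mu]_(s in E) (g s)%:E <= (- \int[mu]_(s in D) f s)%:E)%E.
Proof.
move=> mD finD g0 M0 fM gf.
rewrite /Rintegral integralE; set P := (X in (X - _)%E); set N := (X in (_ - X)%E).
have -> : P = 0%E.
  apply/eqP; rewrite eq_le integral_ge0// andbT -(@integral0 _ _ _ mu D).
  apply: le_integral_ae => //.
  apply: ae_imply fM => s fM /fM[f0 _]; left.
  by rewrite funeposE -EFin_max max_r.
have N0 : (0 <= N)%E by exact: integral_ge0.
have Nfin : N \is a fin_num.
  rewrite ge0_fin_numE//; apply: (@le_lt_trans _ _ (\int[mu]_(s in D) M%:E)%E).
    apply: le_integral_ae => //.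
    apply: ae_imply fM => s fM Ds; right; split => //; have [f0 fM'] := fM Ds.
    by rewrite funenegE -EFinN -EFin_max lee_fin ge_max fM' M0.
  by rewrite integral_cst//= lte_mul_pinfty// lee_fin.
rewrite sub0e fineN opprK fineK//; apply: le_integral_ae => [s|s|].
- by rewrite lee_fin.
- exact: funeneg_ge0.
apply: ae_imply gf => s gf Es; right; have [Ds gfs] := gf Es; split => //.
by rewrite funenegE -EFinN -EFin_max lee_fin le_max gfs.
Qed.

End RealIntegrals.

Section Nonlinearity.
Context {R : realType} {U : hilbertType R}.
Variable phi : U -> U.
Hypothesis phi_lip : locally_lipschitz phi.

Lemma locally_lipschitz_continuous : continuous phi.
Proof.
move=> w; have [L Lphi] := phi_lip (hnorm w + 1).
have idw : v @[v --> w] --> w by exact: cvg_id.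
apply/cvg_hnormP => e e0; pose K := Num.max L 1.
have K0 : 0 < K by rewrite lt_max ltr01 orbT.
have near_eK := (cvg_hnormP (FF := nbhs_filter w) _ _).1 idw _ (divr_gt0 e0 K0).
have near_1 := (cvg_hnormP (FF := nbhs_filter w) _ _).1 idw _ (@ltr01 R).
apply: (@filterS2 _ _ (nbhs_filter w)) near_1 near_eK => v v1 ve.
have hv : hnorm v <= hnorm w + 1.
  have := ler_hnormD (v - w) w; rewrite subrK; lra.
have hw : hnorm w <= hnorm w + 1 by lra.
apply: le_lt_trans (Lphi _ _ hv hw) _.
apply: (@le_lt_trans _ _ (K * hnorm (v - w))).
  by rewrite ler_wpM2r// ?hnorm_ge0// le_max lexx.
by rewrite mulrC -ltr_pdivlMr.
Qed.

Lemma locally_lipschitz_growth (r : R) : phi 0 = 0 -> 0 <= r ->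
  exists2 L : R, 0 <= L &
    forall w, hnorm w <= r -> hnorm (phi w) ^+ 2 <= L * hnorm w ^+ 2.
Proof.
move=> phi0 r0; have [L Lphi] := phi_lip r.
(* The square is nonnegative although L itself may be negative. *)
exists (L ^+ 2); first exact: sqr_ge0.
move=> w wr; have := Lphi w 0 wr; rewrite hnorm0 phi0 !subr0 => /(_ r0) h.
by rewrite -exprMn ler_pXn2r// nnegrE ?hnorm_ge0// (le_trans _ h)// hnorm_ge0.
Qed.

End Nonlinearity.

(** On the annulus [delta <= |u| <= M] the lower bound [beta] dominates
[(beta / M^2) |u|^2]; boundedness of the output is what turns the weak damping
at large amplitudes into a quadratic one. *)
Lemma damping_coercive (R : realType) (U : hilbertType R) (phi : U -> U)
    (alpha beta delta M : R) : 0 < alpha -> 0 < beta -> 0 < M ->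
  (forall u : U, hnorm u < delta ->
     alpha * hnorm u ^+ 2 <= inner_re (phi u) u) ->
  (forall u : U, delta <= hnorm u -> beta <= inner_re (phi u) u) ->
  exists2 c : R, 0 < c &
    forall u, hnorm u <= M -> c * hnorm u ^+ 2 <= inner_re (phi u) u.
Proof.
move=> a0 b0 M0 small large; exists (Num.min alpha (beta / M ^+ 2)).
  by rewrite lt_min a0 divr_gt0// exprn_gt0.
move=> u uM; have [ud|du] := ltP (hnorm u) delta.
  apply: le_trans (small u ud).
  by rewrite ler_wpM2r ?sqr_ge0// ge_min lexx.
apply: le_trans (large u du).
apply: (@le_trans _ _ (beta / M ^+ 2 * hnorm u ^+ 2)).
  by rewrite ler_wpM2r ?sqr_ge0// ge_min lexx orbT.
rewrite mulrAC ler_pdivrMr ?exprn_gt0// ler_pM2l//.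
by rewrite ler_pXn2r// nnegrE ?hnorm_ge0// ltW.
Qed.

(** * Passive systems and negative feedback *)

Section Systems.
Context {R : realType} {U X Y : hilbertType R}.
Local Notation mu := (@lebesgue_measure R).
Implicit Types (S : wp_system U X Y) (u v : R -> U).

Lemma ae_neq0 : {ae mu, forall s : R, s != 0}.
Proof.
exists [set 0]; split; [exact: measurable_set1|exact: lebesgue_measure_set1|].
by move=> s /=; case: eqP.
Qed.

Lemma L2_trunc v t : 0 <= t -> L2loc v -> L2 (trunc t v).
Proof.
move=> t0 v2; have mp : measurable ([set s | 0 <= s <= t] : set (measurableTypeR R)).
  exact: (@measurable_itv R `[0, t]).
have t1 : 0 < t + 1 by rewrite ltr_wpDl.
apply: (L2on_cutoff (D := `]0, t + 1[%classic) (measurable_itv _) mp (v2 _ t1)).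
apply: (aeW mu) => s; rewrite /= !in_itv/= andbT => s0 /andP[_ st].
by rewrite s0 (le_lt_trans st)// ltrDl.
Qed.

Lemma L2_cutoff v (p : pred R) :
  measurable ([set s | p s] : set (measurableTypeR R)) -> L2 v -> L2 (cutoff p v).
Proof.
move=> mp v2; apply: L2on_cutoff v2 _ => //.
by apply: (aeW mu).
Qed.

Lemma L2_0 v : L2 v -> L2 (fun=> 0 : U).
Proof.
move=> v2; apply: (@L2_cutoff v xpred0) => //.
by rewrite (_ : [set _ | _] = set0); [exact: measurable0|apply/seteqP; split].
Qed.

Lemma inPhi0 S v t : 0 <= t -> L2 v -> inPhi S t (fun=> 0) = 0.
Proof.
move=> t0 /L2_0 z2; have := inPhi_linear S 1 t0 z2 z2.
rewrite !scale1r addr0.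
by move/eqP; rewrite -subr_eq0 opprD addNKr oppr_eq0 => /eqP.
Qed.

(** The state at [t] is the free evolution of the state at [tau] plus the
response, from rest, to the part of the input after [tau].  By linearity the
input splits at [tau], and the past part is a concatenation with [0]. *)
Lemma mild_state_split S x0 v tau t : 0 <= tau -> tau <= t -> L2 v ->
  mild_state S x0 v t =
    sgT S (t - tau) (mild_state S x0 v tau) +
    mild_state S 0 (cutoff (fun s => tau <= s) v) t.
Proof.
move=> tau0 taut v2; have t0 := le_trans tau0 taut.
have tt0 : 0 <= t - tau by rewrite subr_ge0.
pose past := cutoff (fun s => s < tau) v.
pose future := cutoff (fun s => tau <= s) v.
have past2 : L2 (trunc t past).
  apply/L2_trunc/L2_L2loc/L2_cutoff => //.
  exact: (@measurable_itv R `]-oo, tau[).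
have future2 : L2 (trunc t future).
  apply/L2_trunc/L2_L2loc/L2_cutoff => //.
  rewrite (_ : [set _ | _] = `[tau, +oo[%classic); first exact: measurable_itv.
  by apply/seteqP; split=> s /=; rewrite in_itv/= andbT.
have vE : trunc t v = (fun s => 1 *: trunc t past s + trunc t future s).
  apply/funext => s; rewrite scale1r /trunc /past /future /cutoff.
  by case: (0 <= s <= t); case: (ltP s tau); rewrite ?addr0 ?add0r.
have pastE : trunc t past = concat tau (trunc tau v) (fun=> 0).
  apply/funext => s; rewrite /trunc /past /cutoff /concat.
  case: (ltP s tau) => [st|_]; last by rewrite if_same.
  by rewrite (ltW st) (le_trans (ltW st) taut).
have tE : t = tau + (t - tau) by rewrite subrKC.
rewrite /mild_state vE inPhi_linear// scale1r linear0 add0r addrA; congr (_ + _).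
rewrite pastE {1 2}tE sgTD// inPhiD//; last 2 first.
- by apply/L2_trunc/L2_L2loc.
- exact: L2_0 v2.
by rewrite (inPhi0 _ tt0 v2) addr0 linearD.
Qed.

End Systems.

Section Feedback.
Context {R : realType} {U X : hilbertType R}.
Local Notation mu := (@lebesgue_measure R).
Variables Sigma K : wp_system U X U.
Hypothesis Sigma_passive : impedance_passive Sigma.

Section Linear.
Hypothesis K_feedback : negative_feedback Sigma K.

(** Passivity makes the input map of the feedback system bounded uniformly in
time: from rest, the stored energy is at most twice the integral of
[Re <v - y, y>], whose integrand is at most [|v|^2] by completing the
square. *)
Lemma feedback_state_bound (v : R -> U) t : L2 v -> 0 <= t ->
  ((hnorm (mild_state K 0 v t) ^+ 2)%:E <=
   2%:E * \int[mu]_(s in `]0%R, +oo[) (hnorm (v s) ^+ 2)%:E)%E.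
Proof.
move=> v2 t0; have [+ _] := K_feedback 0 (L2_L2loc v2).
set y := mild_output K 0 v; move=> [y2 [xE yE]].
have u2 : L2loc (fun s => v s - y s).
  move=> tau tau0; have mtau : measurable (`]0, tau[ : set (measurableTypeR R)).
    exact: measurable_itv.
  apply: L2onD => //; first exact: (L2_L2loc v2).
  apply: (L2on_dominated (D := `]0, tau[%classic) (f := y) (c := 1)) => //.
  - exact: y2.
  - apply: (strongly_measurable_comp (F := -%R)); first exact: opp_continuous.
    by have [] := y2 _ tau0.
  - by apply: (aeW mu) => s; right; rewrite mul1r hnorm_opp.
have := Sigma_passive 0 u2 t0; rewrite -xE// hnorm0 expr0n subr0.
set I := Rintegral _ _ _ => xI.
apply: (@le_trans _ _ (2%:E * I%:E)%E); first by rewrite -EFinM lee_fin.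
rewrite lee_pmul2l//; apply: Rintegral_le_lower => [s|].
  exact: sqr_ge0.
apply: ae_imply2 yE ae_neq0 => s yE s0; rewrite /= in_itv/= => /andP[s_ge0 _].
have {}s0 : 0 < s by rewrite lt_neqAle eq_sym s0.
right; split; first by rewrite in_itv/= s0.
rewrite -yE//; have := inner_re_feedback_le (v s) (y s); have := sqr_ge0 (hnorm (v s)); lra.
Qed.

Hypothesis K_stable : strongly_stable K.

(** After a time [tau] beyond which the input has little energy, the state is
the sum of a free evolution, which vanishes by strong stability, and of a
response from rest to that small remainder, which is uniformly small. *)
Lemma feedback_state_vanishes x0 (v : R -> U) : L2 v ->
  mild_state K x0 v t @[t --> +oo] --> (0 : X).
Proof.
move=> v2; apply/cvg_hnormP => e e0.
(* The bound on the response from rest has a factor 2 before the energy. *)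
have d0 : 0 < (e / 2) ^+ 2 / 2 by rewrite divr_gt0// exprn_gt0// divr_gt0.
have [tau [tau0 tail]] := L2_tail v2 d0.
have : \forall z \near +oo, hnorm (sgT K z (mild_state K x0 v tau) - 0) < e / 2.
  apply: (cvg_hnormP _ _).1; [exact: K_stable|exact: divr_gt0].
(* The maximum with 0 ensures that t exceeds tau even when M is negative. *)
move=> [M [_ small]]; exists (Num.max M 0 + tau); split; first exact: num_real.
move=> t Mt; have taut : tau < t.
  by apply: le_lt_trans Mt; rewrite lerDr le_max lexx orbT.
rewrite subr0 (mild_state_split _ _ (ltW tau0) (ltW taut) v2).
apply: le_lt_trans (ler_hnormD _ _) _; rewrite [e]splitr ltrD//.
  rewrite -[X in hnorm X]subr0; apply: small; rewrite ltrBrDr.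
  by apply: le_lt_trans Mt; rewrite lerD2r le_max lexx.
have w2 : L2 (cutoff (fun s => tau <= s) v).
  apply: L2_cutoff v2.
  rewrite (_ : [set _ | _] = `[tau, +oo[%classic); first exact: measurable_itv.
  by apply/seteqP; split=> s /=; rewrite in_itv/= andbT.
have bound := feedback_state_bound w2 (ltW (lt_trans tau0 taut)).
have e20 : 0 <= e / 2 by rewrite divr_ge0// ltW.
rewrite -(@ltr_pXn2r _ 2)// ?nnegrE ?hnorm_ge0// -lte_fin.
apply: (le_lt_trans bound).
have -> : ((e / 2) ^+ 2)%:E = (2%:E * ((e / 2) ^+ 2 / 2)%:E)%E.
  by rewrite -EFinM mulrCA divff ?mulr1.
by rewrite lte_pmul2l.
Qed.

End Linear.

(** With input [phi (- y)] the supplied power is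
[- Re <phi (- y), - y> <= - c |y|^2], so the passivity inequality bounds
[c] times the energy of [y] on every interval by half of [|x0|^2].  The input
is then square integrable because [phi] grows at most linearly on the range
of [- y]. *)
Lemma nonlinear_solution_L2 (phi : U -> U) x0 x y :
  locally_lipschitz phi -> phi 0 = 0 ->
  (exists alpha beta delta : R,
       [/\ 0 < alpha, 0 < beta & 0 < delta] /\
       (forall u : U, hnorm u < delta ->
          alpha * hnorm u ^+ 2 <= inner_re (phi u) u) /\
       (forall u : U, delta <= hnorm u -> beta <= inner_re (phi u) u)) ->
  nonlinear_solution Sigma phi x0 x y -> L2 y /\ L2 (fun s => phi (- y s)).
Proof.
move=> phi_lip phi0 [al [be [de [[al0 be0 _] [small large]]]]].
move=> [_ [my [M0 yM0]] [xE yE]].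
pose M := Num.max M0 1; have M_gt0 : 0 < M by rewrite lt_max ltr01 orbT.
have yM : {ae mu, forall s, 0 < s -> hnorm (- y s) <= M}.
  by apply: ae_imply yM0 => s yM0 s0; rewrite hnorm_opp le_max yM0.
have [c c0 coer] := damping_coercive al0 be0 M_gt0 small large.
have [L L0 growth] := locally_lipschitz_growth phi_lip phi0 (ltW M_gt0).
have mw : strongly_measurable `]0, +oo[ (fun s => - y s).
  by apply: (strongly_measurable_comp (F := -%R)) my; exact: opp_continuous.
have mphi : strongly_measurable `]0, +oo[ (fun s => phi (- y s)).
  by apply: strongly_measurable_comp mw; exact: locally_lipschitz_continuous.
have u2loc : L2loc (fun s => phi (- y s)).
  apply: (bounded_L2loc (M := Num.sqrt (L * M ^+ 2)) mphi).
  apply: ae_imply yM => s yM s0.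
  rewrite -(@ler_pXn2r _ 2)// ?nnegrE ?hnorm_ge0 ?sqrtr_ge0// sqr_sqrtr; last first.
    by rewrite mulr_ge0// sqr_ge0.
  apply: le_trans (growth _ (yM s0)) _; rewrite ler_wpM2l//.
  by rewrite ler_pXn2r// ?nnegrE ?hnorm_ge0 ?(ltW M_gt0) ?yM.
have inner_re_oppE s :
    inner_re (phi (- y s)) (y s) = - inner_re (phi (- y s)) (- y s).
  by rewrite inner_reNr opprK.
have y2 : L2 y.
  apply: (@L2_of_bounded_energy _ _ y c (hnorm x0 ^+ 2 / 2)) => // t t0.
  have := Sigma_passive x0 u2loc (ltW t0).
  set I := Rintegral _ _ _ => passive.
  apply: (@le_trans _ _ (- I)%:E); last first.
    rewrite lee_fin; have := sqr_ge0 (hnorm (mild_state Sigma x0 (fun s => phi (- y s)) t)).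
    lra.
  (* Re <phi w, w> is at most half of |phi w|^2 + |w|^2, with |w| <= M. *)
  apply: (Rintegral_le0_ge (M := (L * M ^+ 2 + M ^+ 2) / 2)).
  - exact: measurable_itv.
  - by rewrite lebesgue_measure_itv/= lte_fin t0 -EFinB ltry.
  - by move=> s; exact: (mulr_ge0 (ltW c0) (sqr_ge0 _)).
  - by rewrite divr_ge0// addr_ge0 ?(mulr_ge0 L0) ?sqr_ge0.
  - have := ae_imply2 (fun s h1 h2 => conj h1 h2) yE ae_neq0.
    apply: ae_imply2 yM => s yM [yE' s0]; rewrite /= in_itv/= => /andP[s_ge0 _].
    have {}s0 : 0 < s by rewrite lt_neqAle eq_sym s0.
    rewrite -(yE' s0) inner_re_oppE.
    have wM := yM s0; have := coer _ wM; have := growth _ wM.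
    have := inner_re_le (phi (- y s)) (- y s).
    have cw : 0 <= c * hnorm (- y s) ^+ 2 by exact: (mulr_ge0 (ltW c0) (sqr_ge0 _)).
    have w2M : hnorm (- y s) ^+ 2 <= M ^+ 2.
      by rewrite ler_pXn2r// ?nnegrE ?hnorm_ge0 ?(ltW M_gt0).
    have Lw2M := ler_wpM2l L0 w2M.
    split; lra.
  - apply: ae_imply2 yM yE => s yM yE' /=.
    rewrite !in_itv/= => /andP[s0 st]; split; first by rewrite !ltW.
    rewrite -(yE' s0) inner_re_oppE opprK -(hnorm_opp (y s)).
    exact: coer _ (yM s0).
split=> //; apply: (L2on_dominated _ L0 y2 mphi); first exact: measurable_itv.
apply: ae_imply yM => s yM; rewrite /= in_itv/= => /andP[s0 _].
right; split; first by rewrite s0.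
by have := growth _ (yM s0); rewrite hnorm_opp.
Qed.

End Feedback.

(** * Strong stability of the nonlinear loop *)

Theorem proposition4p4 (R : realType) (U X : hilbertType R)
    (Sigma : wp_system U X U) (phi : U -> U) (K : wp_system U X U)
    (Sigma_passive : impedance_passive Sigma)
    (phi_lip : locally_lipschitz phi) (phi0 : phi 0 = 0)
    (phi_damping : exists alpha beta delta : R,
       [/\ 0 < alpha, 0 < beta & 0 < delta] /\
       (forall u : U, hnorm u < delta ->
          alpha * hnorm u ^+ 2 <= inner_re (phi u) u) /\
       (forall u : U, delta <= hnorm u -> beta <= inner_re (phi u) u))
    (K_feedback : negative_feedback Sigma K) (K_stable : strongly_stable K) :
  (forall (x0 : X) (x : R -> X) (y : R -> U),
     nonlinear_solution Sigma phi x0 x y -> stable_solution phi x y) /\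
  ((forall x0 : X, exists x y, nonlinear_solution Sigma phi x0 x y) ->
   forall x0 : X, exists x y,
     nonlinear_solution Sigma phi x0 x y /\ stable_solution phi x y).
Proof.
have stable x0 x y : nonlinear_solution Sigma phi x0 x y -> stable_solution phi x y.
  move=> sol; have [y2 u2] :=
    nonlinear_solution_L2 Sigma_passive phi_lip phi0 phi_damping sol.
  have [_ _ mild] := sol; split => //.
  (* With this external input the loop u = v - y reproduces u = phi (- y). *)
  pose v s := phi (- y s) + y s.
  have v2 : L2 v by apply: L2onD => //; exact: measurable_itv.
  have [|xE _] := (K_feedback x0 v (L2_L2loc v2)).2 x y.
    split; first exact: L2_L2loc.
    by rewrite (_ : (fun s => v s - y s) = (fun s => phi (- y s)))//;
      apply/funext => s; rewrite /v addrK.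
  apply: cvg_trans (feedback_state_vanishes Sigma_passive K_feedback K_stable x0 v2).
  apply: near_eq_cvg; near=> t.
  by rewrite xE//; near: t; exact: nbhs_pinfty_ge.
split=> // all_sol x0; have [x [y sol]] := all_sol x0.
by exists x, y; split => //; exact: stable sol.
Unshelve. all: by end_near. Qed.
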